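(* Let $r\in\mathbb{N}=\{1,2,\dots\}$, let $c>0$, and let $x\in\mathbb{R}$ with $0<x<2c$. Then $$\sum_{n=1}^\infty\frac{1}{n^{2r+1}}\cos\frac{n\pi x}{c}=\sum_{k=0}^{r-1}\frac{(-1)^k}{(2k)!}\left(\frac{\pi x}{c}\right)^{2k}\zeta(2r+1-2k)+(-1)^{r-1}\left(\frac{\pi}{c}\right)^{2r}I_{2r}\!\left[\ln\left(2\sin\frac{\pi t}{2c}\right)\right](x)$$ and $$\sum_{n=1}^\infty\frac{1}{n^{2r}}\sin\frac{n\pi x}{c}=\sum_{k=1}^{r-1}\frac{(-1)^{k-1}}{(2k-1)!}\left(\frac{\pi x}{c}\right)^{2k-1}\zeta(2r+1-2k)+(-1)^{r}\left(\frac{\pi}{c}\right)^{2r-1}I_{2r-1}\!\left[\ln\left(2\sin\frac{\pi t}{2c}\right)\right](x).$$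
   Context: $\zeta$ denotes the Riemann zeta function. For $m\in\mathbb{N}$ and an integrable function $f$ on $(0,x]$, $I_m[f(t)](x)$ denotes the $m$-fold iterated integral from $0$ to $x$, i.e. $I_1[f](x)=\int_0^x f(t)\,dt$ and $I_{m+1}[f](x)=\int_0^x I_m[f](u)\,du$; equivalently $I_m[f](x)=\int_0^x\frac{(x-t)^{m-1}}{(m-1)!}f(t)\,dt$. An empty sum is zero. *)

(* Defs.v *)
From Stdlib Require Import Reals.
From Coquelicot Require Import Coquelicot.
Open Scope R_scope.

(** Dirichlet series of the Riemann zeta function at a real argument; it is the
    value of zeta only for [s > 1], where the series converges. *)
Definition zeta (s : R) : R := Series (fun n => / Rpower (INR (S n)) s).

(** [iter_int m f x] is I_m[f(t)](x).  The integrals are improper at the lower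
    end 0, since [f] may be unbounded there.  The convention I_0[f] = f makes the
    recursion start at I_1[f](x) = int_0^x f. *)
Fixpoint iter_int (m : nat) (f : R -> R) (x : R) {struct m} : R :=
  match m with
  | O => f x
  | S m' => RInt_gen (fun u => iter_int m' f u) (at_right 0) (at_point x)
  end.

(* Main.v *)
Require Import Defs.
From Stdlib Require Import Arith Reals Lra Lia PSeries_reg Ranalysis5.
From Coquelicot Require Import Coquelicot.
Open Scope R_scope.

(** Put y = PI x / c.  The partial sums of [sum cos (n y) / n] converge to
    [- ln (2 sin (y / 2))] locally uniformly on (0, 2 PI): adding
    [ln (2 sin (y / 2)) - sin ((N + 1/2) y) / ((2 N + 1) sin (y / 2))] to the N-th one
    gives, by the closed form of [sum sin (n y)], a function whose derivative is O(1/N),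
    and at y = PI it tends to [0] by the alternating harmonic series.  So
    [sum sin (n y) / n^2], which is continuous and vanishes at 0, is the primitive of
    [- ln (2 sin (y / 2))].  Every further integration from 0 raises the exponent
    by one and switches sine and cosine; the value at 0 of each cosine series is a zeta
    value, whose repeated integrals form the polynomial part. *)

(* Coquelicot lemmas leave equations typed over structures that unfold to R, which
   [ring] and [field] do not recognise. *)
Ltac eq_over_R := match goal with |- @eq _ ?a ?b => change (@eq R a b) end.

(** * Series dominated by 1/n^2: rate of convergence, continuity, termwise differentiation *)

Lemma INR_S_pos (n : nat) : 0 < INR (S n).
Proof. apply lt_0_INR; lia. Qed.

(** Telescoping: 1/(p+1)^2 <= 1/p - 1/(p+1). Keeping the subtracted last term in the bound is what
    lets the induction on [k] close. *)
Lemma tail_bound (a : nat -> R) :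
  (forall n, Rabs (a n) <= / INR (S n) ^ 2) ->
  forall N k, Rabs (sum_n a (N + k) - sum_n a N) <= / INR (S N) - / INR (S (N + k)).
Proof.
  intros Ha N k; induction k as [|k IH].
  - rewrite Nat.add_0_r, !Rminus_diag, Rabs_R0; lra.
  - rewrite Nat.add_succ_r, sum_Sn; change plus with Rplus.
    replace (sum_n a (N + k) + a (S (N + k)) - sum_n a N)
      with ((sum_n a (N + k) - sum_n a N) + a (S (N + k))) by ring.
    eapply Rle_trans; [apply Rabs_triang|].
    specialize (Ha (S (N + k))).
    rewrite (S_INR (S (N + k))) in Ha |- *.
    pose proof (INR_S_pos (N + k)) as Hp.
    set (p := INR (S (N + k))) in *.
    assert (/ (p + 1) ^ 2 <= / p - / (p + 1)).
    { replace (/ p - / (p + 1)) with (/ (p * (p + 1))) by (field; lra).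
      apply Rinv_le_contravar; nra. }
    lra.
Qed.

Lemma ex_series_inv_square (a : nat -> R) :
  (forall n, Rabs (a n) <= / INR (S n) ^ 2) -> ex_series a.
Proof.
  intros Ha.
  apply ex_series_Reals_1, Rcomplete.R_complete.
  intros eps Heps.
  destruct (archimed_cor1 (eps / 2)) as [M [HM HM0]]; [lra|].
  assert (Hd : forall n, (n >= M)%nat ->
    Rabs (sum_f_R0 a n - sum_f_R0 a M) < eps / 2).
  { intros n Hn. rewrite <- !sum_n_Reals.
    replace n with (M + (n - M))%nat by lia.
    eapply Rle_lt_trans; [apply tail_bound, Ha|].
    pose proof (Rinv_0_lt_compat _ (INR_S_pos (M + (n - M)))).
    assert (/ INR (S M) <= / INR M).
    { apply Rinv_le_contravar; [now apply lt_0_INR | apply le_INR; lia]. }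
    lra. }
  exists M; intros n m Hn Hm; unfold R_dist, Rdist.
  pose proof (Hd n Hn); pose proof (Hd m Hm).
  replace (sum_f_R0 a n - sum_f_R0 a m)
    with ((sum_f_R0 a n - sum_f_R0 a M) - (sum_f_R0 a m - sum_f_R0 a M)) by ring.
  eapply Rle_lt_trans; [apply Rabs_triang|]. rewrite Rabs_Ropp. lra.
Qed.

(** Obtained from [tail_bound] by letting [k] tend to infinity. The rate depends only on [N], so for
    a family of functions it is uniform in the variable. *)
Lemma Series_rate_inv_square (a : nat -> R) :
  (forall n, Rabs (a n) <= / INR (S n) ^ 2) ->
  forall N, Rabs (Series a - sum_n a N) <= 1 / INR (S N).
Proof.
  intros Ha N.
  pose proof (Series_correct _ (ex_series_inv_square a Ha)) as Hs.
  assert (L : is_lim_seq (sum_n a) (Series a)) by exact Hs.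
  apply (is_lim_seq_incr_n _ N) in L.
  assert (L1 : is_lim_seq (fun k => sum_n a (k + N) - sum_n a N) (Series a - sum_n a N)).
  { apply is_lim_seq_minus'; [exact L | apply is_lim_seq_const]. }
  apply is_lim_seq_abs in L1.
  apply (is_lim_seq_le _ _ (Rabs (Series a - sum_n a N)) (1 / INR (S N))) with (2 := L1)
    (3 := is_lim_seq_const _).
  intros k. rewrite Nat.add_comm.
  pose proof (tail_bound a Ha N k).
  pose proof (Rinv_0_lt_compat _ (INR_S_pos (N + k))). lra.
Qed.

Lemma CVU_of_rate (fn : nat -> R -> R) (f : R -> R) (c : R) (r : posreal) (K : R) :
  (forall N y, Boule c r y -> Rabs (f y - fn N y) <= K / INR (S N)) ->
  CVU fn f c r.
Proof.
  intros H eps Heps.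
  (* [K] carries no sign hypothesis; [Rabs K + 1] is a positive majorant that can be divided by. *)
  assert (HK : 0 < Rabs K + 1) by (pose proof (Rabs_pos K); lra).
  destruct (archimed_cor1 (eps / (Rabs K + 1))) as [M [HM HM0]].
  { now apply Rdiv_lt_0_compat. }
  exists M; intros n y Hn Hy.
  eapply Rle_lt_trans; [apply H, Hy|].
  apply Rle_lt_trans with ((Rabs K + 1) * / INR M).
  - unfold Rdiv. pose proof (Rle_abs K).
    apply Rle_trans with ((Rabs K + 1) * / INR (S n)).
    + apply Rmult_le_compat_r; [|lra]. left; apply Rinv_0_lt_compat, INR_S_pos.
    + apply Rmult_le_compat_l; [lra|].
      apply Rinv_le_contravar; [now apply lt_0_INR | apply le_INR; lia].
  - replace eps with ((Rabs K + 1) * (eps / (Rabs K + 1))) by (field; lra).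
    now apply Rmult_lt_compat_l.
Qed.

Lemma continuous_sum_n (u : nat -> R -> R) (N : nat) (x : R) :
  (forall n, continuous (u n) x) -> continuous (fun y => sum_n (fun n => u n y) N) x.
Proof.
  intros Hc; induction N as [|N IH].
  - apply continuous_ext with (u 0%nat); [|apply Hc].
    intros z; now rewrite sum_O.
  - apply (continuous_ext (fun z => plus (sum_n (fun n => u n z) N) (u (S N) z))).
    + intros z; now rewrite sum_Sn.
    + apply (continuous_plus (V := R_NormedModule)); [exact IH | apply Hc].
Qed.

Lemma continuous_Series (u : nat -> R -> R) (x : R) :
  (forall n y, Rabs (u n y) <= / INR (S n) ^ 2) ->
  (forall n y, continuous (u n) y) ->
  continuous (fun y => Series (fun n => u n y)) x.
Proof.
  intros Hu Hc.
  apply continuity_pt_filterlim.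
  (* The domination holds on the whole line, so the radius 1 of the ball is arbitrary. *)
  apply (CVU_continuity (fun N y => sum_n (fun n => u n y) N) _ x (mkposreal 1 Rlt_0_1)).
  - apply CVU_of_rate with (K := 1). intros N y _.
    apply (Series_rate_inv_square (fun n => u n y)); auto.
  - intros N y _. apply continuity_pt_filterlim, continuous_sum_n; auto.
  - unfold Boule; simpl. rewrite Rminus_diag, Rabs_R0; lra.
Qed.

(** Only the original series has to be dominated; the differentiated one merely converges uniformly
    on a ball. This covers [sin_zeta 2], whose termwise derivative, the sum of cos (n y) / n, is not
    dominated by 1/n^2. *)
Lemma is_derive_Series_of_CVU (u u' : nat -> R -> R) (g : R -> R) (c : R) (r : posreal)
    (x : R) :
  (forall n y, Rabs (u n y) <= / INR (S n) ^ 2) ->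
  (forall n y, is_derive (u n) y (u' n y)) ->
  (forall n y, continuous (u' n) y) ->
  CVU (fun N y => sum_n (fun n => u' n y) N) g c r ->
  Boule c r x ->
  is_derive (fun y => Series (fun n => u n y)) x (g x).
Proof.
  intros Hu Hd Hc' Hcv Hx.
  apply is_derive_Reals.
  apply (derivable_pt_lim_CVU (fun N y => sum_n (fun n => u n y) N)
    (fun N y => sum_n (fun n => u' n y) N) _ g x c r Hx).
  - intros y N _. apply is_derive_Reals.
    apply (is_derive_sum_n (V := R_NormedModule) u N y (fun n => u' n y)). intros; apply Hd.
  - intros y _. apply is_lim_seq_Reals.
    apply (Series_correct (fun n => u n y)), ex_series_inv_square; auto.
  - exact Hcv.
  - intros y Hy. eapply CVU_continuity; [exact Hcv | | exact Hy].
    intros N z _. apply continuity_pt_filterlim, continuous_sum_n; auto.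
Qed.

Lemma is_derive_Series (u u' : nat -> R -> R) (x : R) :
  (forall n y, Rabs (u n y) <= / INR (S n) ^ 2) ->
  (forall n y, Rabs (u' n y) <= / INR (S n) ^ 2) ->
  (forall n y, is_derive (u n) y (u' n y)) ->
  (forall n y, continuous (u' n) y) ->
  is_derive (fun y => Series (fun n => u n y)) x (Series (fun n => u' n x)).
Proof.
  intros Hu Hu' Hd Hc.
  apply (is_derive_Series_of_CVU u u' (fun y => Series (fun n => u' n y)) x
    (mkposreal 1 Rlt_0_1)); auto.
  - apply CVU_of_rate with (K := 1). intros N y _.
    apply (Series_rate_inv_square (fun n => u' n y)); auto.
  - unfold Boule; simpl. rewrite Rminus_diag, Rabs_R0; lra.
Qed.

Lemma sum_n_opp (u : nat -> R) (N : nat) : sum_n (fun n => - u n) N = - sum_n u N.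
Proof.
  induction N as [|N IH]; [now rewrite !sum_O|].
  rewrite !sum_Sn, IH; change plus with Rplus. eq_over_R; ring.
Qed.

(** * Rate of convergence of the alternating harmonic series *)

Lemma is_derive_pow_div (n : nat) (y : R) :
  is_derive (fun z => z ^ S n / INR (S n)) y (y ^ n).
Proof.
  pose proof (INR_S_pos n).
  auto_derive; [trivial|].
  change (match n with O => 1 | S _ => INR n + 1 end) with (INR (S n)).
  eq_over_R; field; lra.
Qed.

Lemma sum_alternating_pow (y : R) (N : nat) : 1 + y <> 0 ->
  sum_n (fun n => (-1) ^ n * y ^ n) N = (1 - (- y) ^ S N) / (1 + y).
Proof.
  intros Hy; induction N as [|N IH]; [rewrite sum_O; eq_over_R; simpl; field; exact Hy|].
  rewrite sum_Sn, IH; eq_over_R; change plus with Rplus.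
  rewrite <- Rpow_mult_distr. replace (-1 * y) with (- y) by ring.
  rewrite <- (tech_pow_Rmult (- y) (S N)). field; exact Hy.
Qed.

(** The difference [h] between the Taylor polynomial of ln (1 + y) and the logarithm itself vanishes
    at 0, and by the geometric sum its derivative is - (- y)^(N+1) / (1 + y), at most y^(N+1) in
    absolute value on [0, 1]. *)
Lemma alternating_harmonic_rate (N : nat) :
  Rabs (sum_n (fun n => (-1) ^ n / INR (S n)) N - ln 2) <= 1 / INR (S N).
Proof.
  set (h := fun y => sum_n (fun n => (-1) ^ n * (y ^ S n / INR (S n))) N - ln (1 + y)).
  (* |h'| <= k' on [0, 1], so |h 1| <= k 1. *)
  set (k := fun y => y ^ S (S N) / INR (S (S N))).
  assert (Hdh : forall y, 0 <= y ->
    is_derive h y (- ((- y) ^ S N / (1 + y)))).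
  { intros y Hy. unfold h.
    replace (- ((- y) ^ S N / (1 + y))) with (sum_n (fun n => (-1) ^ n * y ^ n) N - 1 / (1 + y)).
    - apply (is_derive_minus (V := R_NormedModule)).
      + apply (is_derive_sum_n (V := R_NormedModule)
          (fun n y => (-1) ^ n * (y ^ S n / INR (S n))) N y).
        intros n _. apply is_derive_scal, is_derive_pow_div.
      + auto_derive; lra.
    - rewrite sum_alternating_pow by lra. field; lra. }
  assert (Hdk : forall y, is_derive k y (y ^ S N)) by (intros y; apply is_derive_pow_div).
  (* Taking [s] = 1 and [s] = -1 gives both sides of the bound from one argument: [k - s * h]
     vanishes at 0 and has a nonnegative derivative on [0, 1]. *)
  assert (Hs : forall s, Rabs s = 1 -> s * h 1 <= k 1).
  { intros s Hs.
    assert (Hd : forall y, 0 <= y ->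
      is_derive (fun y => k y - s * h y) y (y ^ S N - s * - ((- y) ^ S N / (1 + y)))).
    { intros y Hy.
      apply (is_derive_minus (V := R_NormedModule) k (fun y => s * h y)); [apply Hdk|].
      apply is_derive_scal, Hdh, Hy. }
    destruct (MVT_gen (fun y => k y - s * h y) 0 1
      (fun y => y ^ S N - s * - ((- y) ^ S N / (1 + y)))) as [y [Hy Heq]].
    - rewrite Rmin_left, Rmax_right by lra; intros y Hy. apply Hd; lra.
    - rewrite Rmin_left, Rmax_right by lra; intros y Hy.
      apply continuity_pt_filterlim, (ex_derive_continuous (V := R_NormedModule) (fun y => k y - s * h y)).
      eexists. apply Hd; lra.
    - rewrite Rmin_left, Rmax_right in Hy by lra.
      assert (Hk0 : k 0 = 0) by (unfold k; simpl; unfold Rdiv; ring).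
      assert (Hh0 : h 0 = 0).
      { unfold h. rewrite Rplus_0_r, ln_1, Rminus_0_r.
        rewrite (sum_n_ext _ (fun _ => zero)).
        - apply (sum_n_m_const_zero (G := R_AbelianMonoid)).
        - intros n. simpl; unfold Rdiv; change zero with 0; ring. }
      cut (0 <= y ^ S N - s * - ((- y) ^ S N / (1 + y))); [nra|].
      assert (Hb : Rabs (s * - ((- y) ^ S N / (1 + y))) <= y ^ S N).
      { rewrite Rabs_mult, Hs, Rabs_Ropp, Rmult_1_l.
        unfold Rdiv; rewrite Rabs_mult, <- RPow_abs, Rabs_Ropp.
        rewrite (Rabs_pos_eq y), (Rabs_pos_eq (/ (1 + y))); [|left; apply Rinv_0_lt_compat; lra|lra].
        assert (/ (1 + y) <= 1) by (rewrite <- Rinv_1; apply Rinv_le_contravar; lra).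
        assert (0 <= y ^ S N) by (apply pow_le; lra). nra. }
      pose proof (Rle_abs (s * - ((- y) ^ S N / (1 + y)))). lra. }
  assert (Hk1 : k 1 <= 1 / INR (S N)).
  { unfold k. rewrite pow1. unfold Rdiv; rewrite !Rmult_1_l.
    apply Rinv_le_contravar; [apply INR_S_pos | apply le_INR; lia]. }
  assert (Hh1 : h 1 = sum_n (fun n => (-1) ^ n / INR (S n)) N - ln 2).
  { unfold h. f_equal.
    apply sum_n_ext; intros n. rewrite pow1. eq_over_R; unfold Rdiv; ring. }
  rewrite <- Hh1. apply Rabs_le.
  pose proof (Hs 1 Rabs_R1). pose proof (Hs (-1) ltac:(rewrite Rabs_left; lra)). lra.
Qed.

(** * Locally uniform convergence of the sum of cos (n y) / n on (0, 2 PI) *)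

Lemma cos_nat_PI (n : nat) : cos (INR n * PI) = (-1) ^ n.
Proof.
  induction n as [|n IH]; [rewrite Rmult_0_l; apply cos_0|].
  rewrite S_INR, Rmult_plus_distr_r, Rmult_1_l, neg_cos, IH. simpl; ring.
Qed.

(** The product formula turns each term into cos ((n - 1/2) y) - cos ((n + 1/2) y), and the sum
    telescopes. With indices from 0 to [N] the frequencies run from 1 to N + 1, hence the 3/2. *)
Lemma sum_sin_mul_sin_half (y : R) (N : nat) :
  2 * sin (y / 2) * sum_n (fun n => sin (INR (S n) * y)) N
  = cos (y / 2) - cos ((INR N + 3 / 2) * y).
Proof.
  assert (H : forall a, 2 * sin (y / 2) * sin a = cos (a - y / 2) - cos (a + y / 2)).
  { intros a. rewrite cos_minus, cos_plus. ring. }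
  induction N as [|N IH].
  - rewrite sum_O, H. simpl. f_equal; f_equal; lra.
  - rewrite sum_Sn; change plus with Rplus.
    rewrite Rmult_plus_distr_l, IH, H, !S_INR.
    replace ((INR N + 1 + 1) * y - y / 2) with ((INR N + 3 / 2) * y) by lra.
    replace ((INR N + 1 + 1) * y + y / 2) with ((INR N + 1 + 3 / 2) * y) by lra. ring.
Qed.

(** Since sin (y/2) = cos (|y - PI| / 2) and cosine decreases on [0, PI], the denominators sin (y/2)
    stay away from 0 on each closed ball around [PI] of radius less than [PI]. *)
Lemma sin_half_lower (rho y : R) : 0 <= rho < PI -> Rabs (y - PI) <= rho ->
  0 < cos (rho / 2) <= sin (y / 2).
Proof.
  intros Hr Hy. apply Rabs_le_between in Hy. split.
  - apply cos_gt_0; lra.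
  - replace (sin (y / 2)) with (cos (Rabs (y - PI) / 2)).
    + assert (0 <= Rabs (y - PI) <= rho) by (split; [apply Rabs_pos | apply Rabs_le; lra]).
      apply cos_decr_1; lra.
    + unfold Rabs; destruct (Rcase_abs (y - PI)).
      * rewrite sin_cos. replace (PI / 2 + y / 2) with (PI - (PI - y) / 2) by lra.
        rewrite Rtrigo_facts.cos_pi_minus. replace (- (y - PI) / 2) with ((PI - y) / 2) by lra. ring.
      * rewrite sin_cos. replace (PI / 2 + y / 2) with (PI + (y - PI) / 2) by lra.
        rewrite Rtrigo_facts.cos_pi_plus. ring.
Qed.

(** The three terms of the constant come from the mean value theorem for [G] between [PI] and [y],
    from the oscillating correction at [y], and from the value of [G] at [PI]. *)
Lemma cos_series_rate (rho y : R) (N : nat) : 0 <= rho < PI -> Rabs (y - PI) <= rho ->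
  Rabs (- ln (2 * sin (y / 2)) - sum_n (fun n => cos (INR (S n) * y) / INR (S n)) N)
  <= (PI / cos (rho / 2) ^ 2 + / cos (rho / 2) + 2) / INR (S N).
Proof.
  intros Hr Hy.
  set (q := cos (rho / 2)).
  assert (Hq : forall z, Rabs (z - PI) <= rho -> 0 < q <= sin (z / 2))
    by (intros; now apply sin_half_lower).
  set (M := INR N + 3 / 2).
  assert (HS : INR (S N) = M - 1 / 2) by (rewrite S_INR; unfold M; lra).
  assert (HM : 3 / 2 <= M) by (unfold M; pose proof (pos_INR N); lra).
  (* The last term cancels, up to O(1/N), the oscillating part of the derivative of
     the cosine sum. *)
  set (G := fun z => sum_n (fun n => cos (INR (S n) * z) / INR (S n)) N
     + ln (2 * sin (z / 2)) - sin (M * z) / (2 * M * sin (z / 2))).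
  set (G' := fun z => sin (M * z) * cos (z / 2) / (4 * M * sin (z / 2) ^ 2)).
  assert (HG : forall z, Rabs (z - PI) <= rho -> is_derive G z (G' z)).
  { intros z Hz. specialize (Hq z Hz). unfold G, G'.
    (* The closed form of the sine sum cancels the derivative of the logarithm and leaves cos (M z)
       / (2 sin (z/2)), which the derivative of the correction removes. *)
    replace (sin (M * z) * cos (z / 2) / (4 * M * sin (z / 2) ^ 2))
      with (sum_n (fun n => - sin (INR (S n) * z)) N + cos (z / 2) / (2 * sin (z / 2))
        - (cos (M * z) / (2 * sin (z / 2)) - sin (M * z) * cos (z / 2) / (4 * M * sin (z / 2) ^ 2))).
    - apply (is_derive_minus (V := R_NormedModule)); [apply (is_derive_plus (V := R_NormedModule))|].
      + apply (is_derive_sum_n (V := R_NormedModule)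
          (fun n z => cos (INR (S n) * z) / INR (S n)) N z).
        intros n _. pose proof (INR_S_pos n). set (p := INR (S n)) in *.
        auto_derive; [trivial|]. field; lra.
      + auto_derive; [lra|]. change (z * / 2) with (z / 2). eq_over_R; field; lra.
      + auto_derive; [nra|]. change (z * / 2) with (z / 2). eq_over_R; field; lra.
    - pose proof (sum_sin_mul_sin_half z N) as E. fold M in E.
      replace (sum_n (fun n => - sin (INR (S n) * z)) N)
        with (- ((cos (z / 2) - cos (M * z)) / (2 * sin (z / 2)))).
      + field; lra.
      + rewrite <- E, sum_n_opp. field; lra. }
  assert (HG' : forall z, Rabs (z - PI) <= rho -> Rabs (G' z) <= / (4 * M * q ^ 2)).
  { intros z Hz. specialize (Hq z Hz). unfold G', Rdiv.
    rewrite !Rabs_mult.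
    rewrite <- (Rmult_1_l (/ (4 * M * q ^ 2))), <- (Rmult_1_l 1) at 1.
    apply Rmult_le_compat.
    - apply Rmult_le_pos; apply Rabs_pos.
    - apply Rabs_pos.
    - apply Rmult_le_compat; try apply Rabs_pos; apply Rabs_le; [apply SIN_bound | apply COS_bound].
    - rewrite Rabs_pos_eq.
      + apply Rinv_le_contravar.
        * apply Rmult_lt_0_compat; [lra | apply pow_lt; lra].
        * apply Rmult_le_compat_l; [lra | apply pow_incr; lra].
      + left; apply Rinv_0_lt_compat, Rmult_lt_0_compat; [lra | apply pow_lt; lra]. }
  destruct (MVT_cor4 G G' PI rho HG y Hy) as [z [Hz Hzy]].
  assert (HGy : Rabs (G y - G PI) <= / (4 * M * q ^ 2) * PI).
  { rewrite Hz, Rabs_mult. apply Rmult_le_compat; try apply Rabs_pos; [apply HG'|]; lra. }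
  (* At [PI] the cosine sum is minus the alternating harmonic sum, so it cancels [ln 2] up to
     O(1/N). *)
  assert (HGP : Rabs (G PI) <= 1 / INR (S N) + / (2 * M)).
  { unfold G. rewrite sin_PI2, Rmult_1_r.
    replace (sum_n (fun n => cos (INR (S n) * PI) / INR (S n)) N)
      with (- sum_n (fun n => (-1) ^ n / INR (S n)) N).
    - replace (- sum_n (fun n => (-1) ^ n / INR (S n)) N + ln 2 - sin (M * PI) / (2 * M * 1))
        with (- (sum_n (fun n => (-1) ^ n / INR (S n)) N - ln 2) - sin (M * PI) * / (2 * M))
        by (field; lra).
      eapply Rle_trans; [apply Rabs_triang|]. rewrite !Rabs_Ropp, Rabs_mult.
      pose proof (alternating_harmonic_rate N).
      assert (0 < / (2 * M)) by (apply Rinv_0_lt_compat; lra).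
      rewrite (Rabs_pos_eq (/ (2 * M))) by lra.
      assert (Rabs (sin (M * PI)) <= 1) by (apply Rabs_le, SIN_bound). nra.
    - rewrite <- sum_n_opp. apply sum_n_ext; intros n. rewrite cos_nat_PI. simpl pow.
      eq_over_R; unfold Rdiv; ring. }
  assert (Hl : Rabs (sin (M * y) / (2 * M * sin (y / 2))) <= / (2 * M * q)).
  { specialize (Hq y Hy). unfold Rdiv. rewrite Rabs_mult.
    rewrite <- (Rmult_1_l (/ (2 * M * q))).
    apply Rmult_le_compat; try apply Rabs_pos; [apply Rabs_le, SIN_bound|].
    rewrite Rabs_pos_eq; [apply Rinv_le_contravar | left; apply Rinv_0_lt_compat]; nra. }
  assert (Hq0 : 0 < q) by (apply (Hq y Hy)).
  replace (- ln (2 * sin (y / 2)) - sum_n (fun n => cos (INR (S n) * y) / INR (S n)) N)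
    with (- (G y - G PI) - G PI - sin (M * y) / (2 * M * sin (y / 2))) by (unfold G; ring).
  assert (B1 : Rabs (- (G y - G PI) - G PI - sin (M * y) / (2 * M * sin (y / 2)))
    <= Rabs (G y - G PI) + Rabs (G PI) + Rabs (sin (M * y) / (2 * M * sin (y / 2)))).
  { eapply Rle_trans; [apply Rabs_triang|]. rewrite Rabs_Ropp. apply Rplus_le_compat_r.
    eapply Rle_trans; [apply Rabs_triang|]. rewrite !Rabs_Ropp. lra. }
  assert (HSp : 0 < INR (S N)) by apply INR_S_pos.
  assert (HPI := PI_RGT_0).
  assert (Hi : forall k, 1 <= k -> / (k * M) <= / INR (S N)) by (intros; apply Rinv_le_contravar; nra).
  pose proof (Hi 2 ltac:(lra)) as H2. pose proof (Hi 4 ltac:(lra)) as H4.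
  assert (/ (4 * M * q ^ 2) * PI <= PI / q ^ 2 / INR (S N)).
  { rewrite Rinv_mult. unfold Rdiv.
    assert (0 < / q ^ 2) by (apply Rinv_0_lt_compat, pow_lt; lra).
    assert (0 < PI * / q ^ 2) by nra. nra. }
  assert (/ (2 * M * q) <= / q / INR (S N)).
  { rewrite Rinv_mult. unfold Rdiv.
    assert (0 < / q) by (apply Rinv_0_lt_compat; lra). nra. }
  unfold Rdiv in *. rewrite !Rmult_plus_distr_r. lra.
Qed.

(** * Integration from 0 with an improper lower end *)

(** The fundamental theorem on [e, x] gives G x - G e, and e tends to 0. The integrand may be
    unbounded at 0; only the primitive has to be continuous there. *)
Lemma RInt_gen_at_right_derive (f G : R -> R) (x : R) : 0 < x ->
  (forall t, 0 < t <= x -> is_derive G t (f t)) ->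
  (forall t, 0 < t <= x -> continuous f t) ->
  continuous G 0 ->
  RInt_gen f (at_right 0) (at_point x) = G x - G 0.
Proof.
  intros Hx Hd Hc HG0.
  apply (is_RInt_gen_unique (V := R_CompleteNormedModule)).
  intros P HP.
  assert (HL : filterlim (fun e => G x - G e) (locally 0) (locally (G x - G 0))).
  { apply (continuous_minus (V := R_NormedModule) (fun _ => G x) G);
      [apply continuous_const | exact HG0]. }
  specialize (HL P HP).
  apply (Filter_prod _ _ _ (fun e => 0 < e < x /\ P (G x - G e)) (fun z => z = x)).
  - unfold at_right, within.
    assert (H1 : locally 0 (fun e => e < x)).
    { exists (mkposreal x Hx). intros e He.
      change (Rabs (e - 0) < x) in He. apply Rabs_def2 in He; lra. }
    generalize (filter_and _ _ H1 HL). apply filter_imp. intros e [He1 He2] He; auto.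
  - reflexivity.
  - intros e z [He HPe] ->. exists (G x - G e). split; [|exact HPe].
    apply (is_RInt_derive (V := R_CompleteNormedModule) G f); simpl;
      rewrite Rmin_left, Rmax_right by lra; intros t Ht; [apply Hd | apply Hc]; lra.
Qed.

(** One integration step in the variable y = PI x / c: the change of variable produces the factor
    [PI / c], and [E 0 = 0] removes the constant of integration. *)
Lemma iter_int_S_primitive (m : nat) (f : R -> R) (c a : R) (e E : R -> R) :
  0 < c -> a <> 0 ->
  (forall y, 0 < y < 2 * PI -> is_derive E y (e y)) ->
  (forall y, 0 < y < 2 * PI -> continuous e y) ->
  continuous E 0 -> E 0 = 0 ->
  (forall x, 0 < x < 2 * c -> e (PI * x / c) = a * iter_int m f x) ->
  forall x, 0 < x < 2 * c -> E (PI * x / c) = a * (PI / c) * iter_int (S m) f x.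
Proof.
  intros Hc Ha Hd Hce HE0 E0 He x Hx.
  pose proof PI_RGT_0 as HPI.
  assert (Hpc : 0 < PI / c) by now apply Rdiv_lt_0_compat.
  assert (Hdom : forall t, 0 < t < 2 * c -> 0 < PI * t / c < 2 * PI).
  { intros t Ht. replace (PI * t / c) with (PI / c * t) by (field; lra). split; [nra|].
    replace (2 * PI) with (PI / c * (2 * c)) by (field; lra). nra. }
  set (G := fun t => E (PI * t / c) / (a * (PI / c))).
  assert (Hlin : forall t, is_derive (fun t => PI * t / c) t (PI / c)).
  { intros t. auto_derive; [trivial|]. eq_over_R; field; lra. }
  assert (Hl0 : continuous (fun t => PI * t / c) 0).
  { apply (ex_derive_continuous (V := R_NormedModule) (fun t => PI * t / c)).
    eexists; apply Hlin. }
  assert (P0 : PI * 0 / c = 0) by (unfold Rdiv; ring).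
  simpl. rewrite (RInt_gen_at_right_derive _ G).
  - unfold G. rewrite P0, E0. field. repeat split; lra.
  - lra.
  - intros t Ht.
    replace (iter_int m f t) with (/ (a * (PI / c)) * (PI / c * e (PI * t / c)))
      by (rewrite He by lra; field; lra).
    apply (is_derive_ext (fun t => / (a * (PI / c)) * E (PI * t / c))).
    { intros z. unfold G. eq_over_R. unfold Rdiv; ring. }
    apply is_derive_scal.
    apply (is_derive_comp (V := R_NormedModule) E (fun t => PI * t / c)); [|apply Hlin].
    apply Hd, Hdom; lra.
  - intros t Ht.
    (* Continuity of [iter_int m f] is read off from [e] through the identity [He], which holds in a
       whole neighbourhood of [t]. *)
    apply (continuous_ext_loc _ (fun t => / a * e (PI * t / c))).
    + assert (H2 : locally t (fun s => 0 < s < 2 * c)).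
      { apply (locally_interval _ t 0 (2 * c)); simpl; try lra. intros; lra. }
      revert H2. apply filter_imp. intros s Hs. rewrite He by exact Hs. eq_over_R; field; lra.
    + apply (continuous_scal_r (V := R_NormedModule) (/ a) (fun t => e (PI * t / c))).
      apply continuous_comp.
      * apply (ex_derive_continuous (V := R_NormedModule) (fun t => PI * t / c)).
        eexists; apply Hlin.
      * apply Hce, Hdom; lra.
  - apply (continuous_ext (fun t => / (a * (PI / c)) * E (PI * t / c))).
    { intros z. unfold G. eq_over_R; unfold Rdiv; ring. }
    apply (continuous_scal_r (V := R_NormedModule) _ (fun t => E (PI * t / c))).
    apply continuous_comp; [exact Hl0|]. rewrite P0. exact HE0.
Qed.

(** * The cosine and sine series and their derivatives *)

(** The real part of the polylogarithm Li_m (exp (i y)); [sin_zeta] is the imaginary part. *)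
Definition cos_zeta (m : nat) (y : R) : R :=
  Series (fun n => / INR (S n) ^ m * cos (INR (S n) * y)).

Definition sin_zeta (m : nat) (y : R) : R :=
  Series (fun n => / INR (S n) ^ m * sin (INR (S n) * y)).

Lemma inv_pow_term_bound (m n : nat) (t : R) : (2 <= m)%nat -> -1 <= t <= 1 ->
  Rabs (/ INR (S n) ^ m * t) <= / INR (S n) ^ 2.
Proof.
  intros Hm Ht.
  assert (1 <= INR (S n)) by (change 1 with (INR 1); apply le_INR; lia).
  rewrite Rabs_mult, <- (Rmult_1_r (/ INR (S n) ^ 2)).
  apply Rmult_le_compat; try apply Rabs_pos; [|now apply Rabs_le].
  assert (0 < INR (S n) ^ 2) by (apply pow_lt; lra).
  rewrite Rabs_pos_eq.
  - apply Rinv_le_contravar; [assumption | now apply Rle_pow].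
  - left; apply Rinv_0_lt_compat, pow_lt; lra.
Qed.

Lemma is_derive_cos_term (m n : nat) (y : R) :
  is_derive (fun y => / INR (S n) ^ S m * cos (INR (S n) * y)) y
    (- (/ INR (S n) ^ m * sin (INR (S n) * y))).
Proof.
  pose proof (INR_S_pos n). set (p := INR (S n)) in *.
  assert (p ^ m <> 0) by (apply pow_nonzero; lra).
  auto_derive; [trivial|]. eq_over_R. simpl pow. field; split; lra.
Qed.

Lemma is_derive_sin_term (m n : nat) (y : R) :
  is_derive (fun y => / INR (S n) ^ S m * sin (INR (S n) * y)) y
    (/ INR (S n) ^ m * cos (INR (S n) * y)).
Proof.
  pose proof (INR_S_pos n). set (p := INR (S n)) in *.
  assert (p ^ m <> 0) by (apply pow_nonzero; lra).
  auto_derive; [trivial|]. eq_over_R. simpl pow. field; split; lra.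
Qed.

Lemma continuous_cos_term (m n : nat) (y : R) :
  continuous (fun y => / INR (S n) ^ m * cos (INR (S n) * y)) y.
Proof.
  apply (ex_derive_continuous (V := R_NormedModule)
    (fun y => / INR (S n) ^ m * cos (INR (S n) * y))).
  auto_derive; trivial.
Qed.

Lemma continuous_sin_term (m n : nat) (y : R) :
  continuous (fun y => / INR (S n) ^ m * sin (INR (S n) * y)) y.
Proof.
  apply (ex_derive_continuous (V := R_NormedModule)
    (fun y => / INR (S n) ^ m * sin (INR (S n) * y))).
  auto_derive; trivial.
Qed.

Lemma continuous_cos_zeta (m : nat) (y : R) : (2 <= m)%nat -> continuous (cos_zeta m) y.
Proof.
  intros Hm. apply (continuous_Series (fun n y => / INR (S n) ^ m * cos (INR (S n) * y))).
  - intros; apply inv_pow_term_bound; [exact Hm | apply COS_bound].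
  - intros; apply continuous_cos_term.
Qed.

Lemma continuous_sin_zeta (m : nat) (y : R) : (2 <= m)%nat -> continuous (sin_zeta m) y.
Proof.
  intros Hm. apply (continuous_Series (fun n y => / INR (S n) ^ m * sin (INR (S n) * y))).
  - intros; apply inv_pow_term_bound; [exact Hm | apply SIN_bound].
  - intros; apply continuous_sin_term.
Qed.

Lemma is_derive_cos_zeta (m : nat) (y : R) : (2 <= m)%nat ->
  is_derive (cos_zeta (S m)) y (- sin_zeta m y).
Proof.
  intros Hm. unfold sin_zeta. rewrite <- Series_opp.
  apply (is_derive_Series (fun n y => / INR (S n) ^ S m * cos (INR (S n) * y))
    (fun n y => - (/ INR (S n) ^ m * sin (INR (S n) * y)))).
  - intros; apply inv_pow_term_bound; [lia | apply COS_bound].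
  - intros; rewrite Rabs_Ropp; apply inv_pow_term_bound; [lia | apply SIN_bound].
  - intros; apply is_derive_cos_term.
  - intros n z. apply (continuous_opp (V := R_NormedModule)), continuous_sin_term.
Qed.

Lemma is_derive_sin_zeta (m : nat) (y : R) : (2 <= m)%nat ->
  is_derive (sin_zeta (S m)) y (cos_zeta m y).
Proof.
  intros Hm.
  apply (is_derive_Series (fun n y => / INR (S n) ^ S m * sin (INR (S n) * y))
    (fun n y => / INR (S n) ^ m * cos (INR (S n) * y))).
  - intros; apply inv_pow_term_bound; [lia | apply SIN_bound].
  - intros; apply inv_pow_term_bound; [lia | apply COS_bound].
  - intros; apply is_derive_sin_term.
  - intros; apply continuous_cos_term.
Qed.

(** The step where the logarithm enters: uniform convergence of the differentiated series comes from
    [cos_series_rate] instead of domination. *)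
Lemma is_derive_sin_zeta_2 (y : R) : 0 < y < 2 * PI ->
  is_derive (sin_zeta 2) y (- ln (2 * sin (y / 2))).
Proof.
  intros Hy.
  assert (Hr : Rabs (y - PI) < PI) by (apply Rabs_def1; lra).
  pose proof (Rabs_pos (y - PI)) as Hp.
  (* The radius is the midpoint between |y - PI| and [PI]: the open ball contains [y], and its
     closure stays inside (0, 2 PI). *)
  assert (Hr0 : 0 < (Rabs (y - PI) + PI) / 2) by lra.
  set (rho := mkposreal _ Hr0).
  apply (is_derive_Series_of_CVU (fun n y => / INR (S n) ^ 2 * sin (INR (S n) * y))
    (fun n y => / INR (S n) ^ 1 * cos (INR (S n) * y))
    (fun y => - ln (2 * sin (y / 2))) PI rho).
  - intros; apply inv_pow_term_bound; [lia | apply SIN_bound].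
  - intros; apply is_derive_sin_term.
  - intros; apply continuous_cos_term.
  - apply CVU_of_rate with (PI / cos (rho / 2) ^ 2 + / cos (rho / 2) + 2).
    intros N z Hz.
    rewrite (sum_n_ext _ (fun n => cos (INR (S n) * z) / INR (S n))).
    + apply cos_series_rate; [simpl; lra | left; exact Hz].
    + intros n. eq_over_R. rewrite pow_1. unfold Rdiv; ring.
  - unfold Boule; simpl; lra.
Qed.

Lemma zeta_INR (m : nat) : zeta (INR m) = Series (fun n => / INR (S n) ^ m).
Proof.
  apply Series_ext; intros n. rewrite Rpower_pow; [reflexivity | apply INR_S_pos].
Qed.

Lemma cos_zeta_0 (m : nat) : cos_zeta m 0 = zeta (INR m).
Proof.
  rewrite zeta_INR. apply Series_ext; intros n. rewrite Rmult_0_r, cos_0; ring.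
Qed.

Lemma sin_zeta_0 (m : nat) : sin_zeta m 0 = 0.
Proof.
  (* Writing the zero term as a product lets [Series_scal_l] pull out the factor 0. *)
  unfold sin_zeta. rewrite (Series_ext _ (fun n => 0 * 0)).
  - rewrite Series_scal_l; ring.
  - intros n. rewrite Rmult_0_r, sin_0; ring.
Qed.

(** * The polynomial parts and their derivatives *)

(** For r >= 1 the zeta arguments run from 2r + 1 down to 3, so the natural subtraction never
    truncates and the pole at 1 is avoided. *)
Definition cos_poly (r : nat) (y : R) : R :=
  sum_n_m (fun k => (-1) ^ k / INR (fact (2 * k)) * y ^ (2 * k)
    * zeta (INR (2 * r + 1 - 2 * k))) 0 (r - 1).

Definition sin_poly (r : nat) (y : R) : R :=
  sum_n_m (fun k => (-1) ^ (k - 1) / INR (fact (2 * k - 1)) * y ^ (2 * k - 1)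
    * zeta (INR (2 * r + 1 - 2 * k))) 1 (r - 1).

Lemma is_derive_pow_fact (j : nat) (a b y : R) :
  is_derive (fun y => a / INR (fact (S j)) * y ^ S j * b) y (a / INR (fact j) * y ^ j * b).
Proof.
  pose proof (INR_fact_neq_0 j). pose proof (INR_S_pos j).
  rewrite fact_simpl, mult_INR.
  auto_derive; [trivial|].
  change (match j with O => 1 | S _ => INR j + 1 end) with (INR (S j)).
  eq_over_R; simpl Init.Nat.pred; field; lra.
Qed.

(** Shifting the index by one aligns the terms with those of [cos_poly (S p)], of which they are
    primitives. *)
Lemma sin_poly_S (p : nat) (y : R) :
  sin_poly (S (S p)) y = sum_n (fun k => (-1) ^ k / INR (fact (S (2 * k))) * y ^ S (2 * k)
    * zeta (INR (2 * S p + 1 - 2 * k))) p.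
Proof.
  unfold sin_poly, sum_n. replace (S (S p) - 1)%nat with (S p) by lia.
  rewrite <- sum_n_m_S. apply sum_n_m_ext; intros k.
  replace (2 * S k - 1)%nat with (S (2 * k)) by lia.
  replace (S k - 1)%nat with k by lia.
  replace (2 * S (S p) + 1 - 2 * S k)%nat with (2 * S p + 1 - 2 * k)%nat by lia.
  reflexivity.
Qed.

Lemma is_derive_sin_poly (p : nat) (y : R) :
  is_derive (sin_poly (S (S p))) y (cos_poly (S p) y).
Proof.
  eapply is_derive_ext; [intros t; symmetry; apply sin_poly_S|].
  unfold cos_poly. replace (S p - 1)%nat with p by lia.
  apply (is_derive_sum_n (V := R_NormedModule)
    (fun k y => (-1) ^ k / INR (fact (S (2 * k))) * y ^ S (2 * k)
    * zeta (INR (2 * S p + 1 - 2 * k))) p y).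
  intros k _. apply is_derive_pow_fact.
Qed.

Lemma is_derive_cos_poly (p : nat) (y : R) :
  is_derive (cos_poly (S p)) y (- sin_poly (S p) y).
Proof.
  (* The derivatives of the terms of [cos_poly]: the constant term drops out, and term j + 1 gives
     minus the j-th term of the reindexed [sin_poly]. *)
  set (d := fun k => match k with O => 0 | S j =>
    (-1) ^ S j / INR (fact (S (2 * j))) * y ^ S (2 * j) * zeta (INR (2 * S p + 1 - 2 * S j)) end).
  replace (- sin_poly (S p) y) with (sum_n d p).
  - unfold cos_poly. replace (S p - 1)%nat with p by lia.
    apply (is_derive_sum_n (V := R_NormedModule)
      (fun k y => (-1) ^ k / INR (fact (2 * k)) * y ^ (2 * k)
        * zeta (INR (2 * S p + 1 - 2 * k))) p y).
    intros [|j] _.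
    + simpl. apply (is_derive_const (V := R_NormedModule)).
    + replace (d (S j)) with ((-1) ^ S j / INR (fact (S (2 * j))) * y ^ S (2 * j)
        * zeta (INR (2 * S p + 1 - S (S (2 * j)))))
        by (unfold d; repeat f_equal; lia).
      replace (2 * S j)%nat with (S (S (2 * j))) by lia. apply is_derive_pow_fact.
  - destruct p as [|p].
    + rewrite sum_O. unfold sin_poly. rewrite sum_n_m_zero by lia.
      change zero with 0. simpl; ring.
    + rewrite sin_poly_S, <- sum_n_opp. unfold sum_n.
      rewrite sum_Sn_m, <- sum_n_m_S by lia.
      change (d 0%nat) with (@zero R_AbelianMonoid). rewrite plus_zero_l.
      apply sum_n_m_ext; intros j. unfold d. eq_over_R.
      replace (2 * S (S p) + 1 - 2 * S j)%nat with (2 * S p + 1 - 2 * j)%nat by lia.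
      simpl pow; unfold Rdiv; ring.
Qed.

Lemma cos_poly_0 (p : nat) : cos_poly (S p) 0 = zeta (INR (2 * S p + 1)).
Proof.
  unfold cos_poly. rewrite sum_Sn_m by lia.
  rewrite (sum_n_m_ext_loc _ (fun _ => zero) 1).
  - rewrite sum_n_m_const_zero, plus_zero_r. simpl Nat.mul.
    rewrite Nat.sub_0_r. simpl pow. simpl fact. change (INR 1) with 1. eq_over_R; field.
  - intros k Hk. replace (2 * k)%nat with (S (2 * k - 1)) by lia.
    rewrite pow_i by lia. change zero with 0. eq_over_R; ring.
Qed.

Lemma sin_poly_0 (r : nat) : sin_poly r 0 = 0.
Proof.
  unfold sin_poly. rewrite (sum_n_m_ext_loc _ (fun _ => zero) 1).
  - apply (sum_n_m_const_zero (G := R_AbelianMonoid)).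
  - intros k Hk. rewrite pow_i by lia. change zero with 0. eq_over_R; ring.
Qed.

Lemma continuous_of_is_derive (f df : R -> R) (y : R) :
  (forall z, is_derive f z (df z)) -> continuous f y.
Proof.
  intros Hd. apply (ex_derive_continuous (V := R_NormedModule) f). eexists; apply Hd.
Qed.

Lemma continuous_cos_poly (p : nat) (y : R) : continuous (cos_poly (S p)) y.
Proof. eapply continuous_of_is_derive; apply is_derive_cos_poly. Qed.

Lemma continuous_sin_poly (p : nat) (y : R) : continuous (sin_poly (S p)) y.
Proof.
  destruct p as [|p].
  - apply (continuous_ext (fun _ => 0)); [|apply continuous_const].
    intros z. unfold sin_poly. now rewrite sum_n_m_zero by lia.
  - eapply continuous_of_is_derive; apply is_derive_sin_poly.
Qed.

Lemma continuous_log_kernel (y : R) : 0 < y < 2 * PI ->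
  continuous (fun y => - ln (2 * sin (y / 2))) y.
Proof.
  intros Hy. apply (ex_derive_continuous (V := R_NormedModule)
    (fun y => - ln (2 * sin (y / 2)))).
  assert (0 < sin (y / 2)) by (apply sin_gt_0; lra).
  auto_derive. change (y * / 2) with (y / 2). lra.
Qed.

(** * Remainders as iterated integrals, by alternating induction *)

(** [sin_poly 1] is an empty sum and [iter_int 0 f] is [f], so this is the integration step applied
    to the logarithm itself with [a] = -1. *)
Lemma sin_remainder_base (c : R) : 0 < c -> forall x, 0 < x < 2 * c ->
  sin_zeta 2 (PI * x / c) - sin_poly 1 (PI * x / c)
  = - 1 * (PI / c) * iter_int 1 (fun t => ln (2 * sin (PI * t / (2 * c)))) x.
Proof.
  intros Hc.
  apply (iter_int_S_primitive 0 _ c (- 1) (fun y => - ln (2 * sin (y / 2)))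
    (fun y => sin_zeta 2 y - sin_poly 1 y)); auto; try lra.
  - intros y Hy. apply (is_derive_ext (sin_zeta 2)).
    + intros t. unfold sin_poly. rewrite sum_n_m_zero by lia. change zero with 0. eq_over_R; ring.
    + now apply is_derive_sin_zeta_2.
  - apply continuous_log_kernel.
  - apply (continuous_minus (V := R_NormedModule));
      [now apply continuous_sin_zeta | apply continuous_sin_poly].
  - rewrite sin_zeta_0, sin_poly_0; ring.
  - intros x Hx. simpl. replace (PI * x / c / 2) with (PI * x / (2 * c)) by (field; lra). ring.
Qed.

(** Differentiating the cosine produces the sign change of [a]. Series and polynomial have the same
    value zeta (2p + 3) at 0, so their difference is the primitive that vanishes there. *)
Lemma cos_remainder_step (m p : nat) (f : R -> R) (c a : R) : 0 < c -> a <> 0 ->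
  (forall x, 0 < x < 2 * c ->
    sin_zeta (2 * S p) (PI * x / c) - sin_poly (S p) (PI * x / c) = a * iter_int m f x) ->
  forall x, 0 < x < 2 * c ->
    cos_zeta (2 * S p + 1) (PI * x / c) - cos_poly (S p) (PI * x / c)
    = - a * (PI / c) * iter_int (S m) f x.
Proof.
  intros Hc Ha IH.
  apply (iter_int_S_primitive m f c (- a)
    (fun y => - (sin_zeta (2 * S p) y - sin_poly (S p) y))
    (fun y => cos_zeta (2 * S p + 1) y - cos_poly (S p) y)); auto; try lra.
  - intros y _.
    replace (- (sin_zeta (2 * S p) y - sin_poly (S p) y))
      with (- sin_zeta (2 * S p) y - - sin_poly (S p) y) by ring.
    rewrite Nat.add_1_r.
    apply (is_derive_minus (V := R_NormedModule));
      [apply is_derive_cos_zeta; lia | apply is_derive_cos_poly].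
  - intros y _. apply (continuous_opp (V := R_NormedModule)
      (fun y => sin_zeta (2 * S p) y - sin_poly (S p) y)).
    apply (continuous_minus (V := R_NormedModule));
      [apply continuous_sin_zeta; lia | apply continuous_sin_poly].
  - apply (continuous_minus (V := R_NormedModule));
      [apply continuous_cos_zeta; lia | apply continuous_cos_poly].
  - rewrite cos_zeta_0, cos_poly_0; ring.
  - intros x Hx. rewrite IH by exact Hx. ring.
Qed.

(** No sign change here, and both the series and the polynomial vanish at 0. *)
Lemma sin_remainder_step (m p : nat) (f : R -> R) (c a : R) : 0 < c -> a <> 0 ->
  (forall x, 0 < x < 2 * c ->
    cos_zeta (2 * S p + 1) (PI * x / c) - cos_poly (S p) (PI * x / c) = a * iter_int m f x) ->
  forall x, 0 < x < 2 * c ->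
    sin_zeta (2 * S (S p)) (PI * x / c) - sin_poly (S (S p)) (PI * x / c)
    = a * (PI / c) * iter_int (S m) f x.
Proof.
  intros Hc Ha IH.
  apply (iter_int_S_primitive m f c a
    (fun y => cos_zeta (2 * S p + 1) y - cos_poly (S p) y)
    (fun y => sin_zeta (2 * S (S p)) y - sin_poly (S (S p)) y)); auto.
  - intros y _.
    replace (2 * S (S p))%nat with (S (2 * S p + 1)) by lia.
    apply (is_derive_minus (V := R_NormedModule));
      [apply is_derive_sin_zeta; lia | apply is_derive_sin_poly].
  - intros y _. apply (continuous_minus (V := R_NormedModule));
      [apply continuous_cos_zeta; lia | apply continuous_cos_poly].
  - apply (continuous_minus (V := R_NormedModule));
      [apply continuous_sin_zeta; lia | apply continuous_sin_poly].
  - rewrite sin_zeta_0, sin_poly_0; ring.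
Qed.

(** Here r = p + 1. The chain runs from sine to cosine at the same [p], then from cosine to sine at
    p + 1; each step adds one integration and one factor [PI / c]. *)
Lemma remainders_iter_int (p : nat) (c : R) : 0 < c ->
  let f := fun t => ln (2 * sin (PI * t / (2 * c))) in
  (forall x, 0 < x < 2 * c ->
    sin_zeta (2 * S p) (PI * x / c) - sin_poly (S p) (PI * x / c)
    = (-1) ^ S p * (PI / c) ^ (2 * p + 1) * iter_int (2 * p + 1) f x)
  /\ (forall x, 0 < x < 2 * c ->
    cos_zeta (2 * S p + 1) (PI * x / c) - cos_poly (S p) (PI * x / c)
    = (-1) ^ p * (PI / c) ^ (2 * S p) * iter_int (2 * S p) f x).
Proof.
  intros Hc f.
  assert (Hpc : PI / c <> 0) by (apply Rgt_not_eq, Rdiv_lt_0_compat; [apply PI_RGT_0 | exact Hc]).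
  assert (Hnz : forall i j, (-1) ^ i * (PI / c) ^ j <> 0).
  { intros i j. apply Rmult_integral_contrapositive; split; apply pow_nonzero; lra. }
  (* The passage from sine to cosine is stated for every [p], since the base case and the inductive
     step both use it. *)
  assert (Hcos : forall p, (forall x, 0 < x < 2 * c ->
    sin_zeta (2 * S p) (PI * x / c) - sin_poly (S p) (PI * x / c)
    = (-1) ^ S p * (PI / c) ^ (2 * p + 1) * iter_int (2 * p + 1) f x) ->
    forall x, 0 < x < 2 * c ->
    cos_zeta (2 * S p + 1) (PI * x / c) - cos_poly (S p) (PI * x / c)
    = (-1) ^ p * (PI / c) ^ (2 * S p) * iter_int (2 * S p) f x).
  { intros q Hq x Hx.
    rewrite (cos_remainder_step _ _ _ _ _ Hc (Hnz _ _) Hq x Hx).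
    replace (2 * S q)%nat with (S (2 * q + 1)) by lia. simpl pow. ring. }
  induction p as [|p [_ IH]].
  - split; [|apply Hcos]; intros x Hx; (etransitivity; [exact (sin_remainder_base c Hc x Hx)|]);
      simpl Nat.mul; simpl Nat.add; simpl pow; fold f; ring.
  - assert (Hs : forall x, 0 < x < 2 * c ->
      sin_zeta (2 * S (S p)) (PI * x / c) - sin_poly (S (S p)) (PI * x / c)
      = (-1) ^ S (S p) * (PI / c) ^ (2 * S p + 1) * iter_int (2 * S p + 1) f x).
    { intros x Hx.
      rewrite (sin_remainder_step _ _ _ _ _ Hc (Hnz _ _) IH x Hx).
      rewrite Nat.add_1_r. simpl pow. ring. }
    split; [exact Hs | now apply Hcos].
Qed.

Theorem theorem3p4 (r : nat) (c x : R) (hr : (1 <= r)%nat) (hc : 0 < c)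
    (hx : 0 < x < 2 * c) :
  is_series
    (fun n => / INR (S n) ^ (2 * r + 1) * cos (INR (S n) * PI * x / c))
    (sum_n_m
       (fun k => (-1) ^ k / INR (fact (2 * k)) * (PI * x / c) ^ (2 * k)
                 * zeta (INR (2 * r + 1 - 2 * k)))
       0 (r - 1)
     + (-1) ^ (r - 1) * (PI / c) ^ (2 * r)
       * iter_int (2 * r) (fun t => ln (2 * sin (PI * t / (2 * c)))) x)
  /\
  is_series
    (fun n => / INR (S n) ^ (2 * r) * sin (INR (S n) * PI * x / c))
    (sum_n_m
       (fun k => (-1) ^ (k - 1) / INR (fact (2 * k - 1))
                 * (PI * x / c) ^ (2 * k - 1)
                 * zeta (INR (2 * r + 1 - 2 * k)))
       1 (r - 1)
     + (-1) ^ r * (PI / c) ^ (2 * r - 1)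
       * iter_int (2 * r - 1) (fun t => ln (2 * sin (PI * t / (2 * c)))) x).
Proof.
  destruct r as [|p]; [lia|].
  destruct (remainders_iter_int p c hc) as [Hs Hc].
  specialize (Hs x hx). specialize (Hc x hx).
  assert (Harg : forall n, INR (S n) * PI * x / c = INR (S n) * (PI * x / c))
    by (intros n; unfold Rdiv; ring).
  replace (2 * S p - 1)%nat with (2 * p + 1)%nat by lia.
  replace ((-1) ^ (S p - 1)) with ((-1) ^ p) by (f_equal; lia).
  (* Replacing the integrals by series minus polynomial cancels the polynomials; only the
     convergence of the two series to their own sums remains. *)
  rewrite <- Hs, <- Hc.
  fold (cos_poly (S p) (PI * x / c)) (sin_poly (S p) (PI * x / c)).
  rewrite !Rplus_minus.
  split.
  - apply (is_series_ext (fun n => / INR (S n) ^ (2 * S p + 1) * cos (INR (S n) * (PI * x / c)))).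
    + intros n; now rewrite Harg.
    + apply Series_correct, ex_series_inv_square.
      intros; apply inv_pow_term_bound; [lia | apply COS_bound].
  - apply (is_series_ext (fun n => / INR (S n) ^ (2 * S p) * sin (INR (S n) * (PI * x / c)))).
    + intros n; now rewrite Harg.
    + apply Series_correct, ex_series_inv_square.
      intros; apply inv_pow_term_bound; [lia | apply SIN_bound].
Qed.
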